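(* For every instance $(A,C,k)$, the committee produced by MES completed by varying the budget and then by AV has representation ratio at least $\frac1k$ and utilitarian ratio at least $\frac{2}{\sqrt{k}}-\frac2k$. Both bounds are asymptotically tight: there is an absolute constant $K>0$ such that for infinitely many $k$ there are instances with committee size $k$ on which this procedure (for some tie-breaking) yields a committee with representation ratio at most $K/k$, and instances on which it yields a committee with utilitarian ratio at most $K/\sqrt{k}$.
   Context: An instance $(A,C,k)$ consists of a finite nonempty candidate set $C$, voters $N=\{1,\dots,n\}$, approval sets $A_i\subseteq C$, and a committee size $1\le k\le|C|$. $N_c=\{i:c\in A_i\}$. $\mathrm{sw}(W)=\sum_i|A_i\cap W|$, $\mathrm{cov}(W)=|\{i:A_i\cap W\ne\emptyset\}|$; utilitarian ratio $\mathrm{sw}(W)/\max\{\mathrm{sw}(W'):|W'|=k\}$, representation ratio $\mathrm{cov}(W)/\max\{\mathrm{cov}(W'):|W'|=k\}$. For a positive integer $k'$, MES with parameter $k'$ starts with $W=\emptyset$ and budgets $b_i=k'/n$; in each round, for each $c\notin W$ it finds $\rho\ge0$ (if any) with $\sum_{i\in N_c}\min(b_i,\rho)=1$; if none exists for any unselected candidate it outputs $W$, otherwise it adds a $c$ with minimum $\rho$ and sets $b_i\leftarrow b_i-\min(b_i,\rho)$ for $i\in N_c$. Completion by varying the budget: let $k^*$ be the smallest integer $k'\ge k$ for which MES with parameter $k'$ selects at least $k$ candidates; if it selects exactly $k$, let $W$ be that committee, otherwise let $W$ be the output of MES with parameter $k^*-1$. Finally $W$ is completed by AV: output $W\cup T$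 with $T\subseteq C\setminus W$, $|T|=k-|W|$, maximizing $\sum_{c\in T}|N_c|$. *)

(* Defs.v *)
From HB Require Import structures.
From mathcomp Require Import all_boot all_order all_algebra.
From mathcomp Require Import boolp reals.
Set Implicit Arguments. Unset Strict Implicit. Unset Printing Implicit Defensive.
Import Order.TTheory GRing.Theory Num.Theory.
Local Open Scope ring_scope.

Section MES.
Variables (R : realType) (C : finType) (n : nat) (A : 'I_n -> {set C}).

Definition Nc (c : C) : {set 'I_n} := [set i | c \in A i].

Definition sw (W : {set C}) : nat := (\sum_i #|A i :&: W|)%N.
Definition cov (W : {set C}) : nat := #|[set i | A i :&: W != set0]|.

Definition max_sw (k : nat) : nat := (\max_(W : {set C} | #|W| == k) sw W)%N.
Definition max_cov (k : nat) : nat := (\max_(W : {set C} | #|W| == k) cov W)%N.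

(* ratios; convention: ratio 1 when the optimum is 0 (0/0) *)
Definition util_ratio (k : nat) (W : {set C}) : R :=
  if max_sw k == 0%N then 1 else (sw W)%:R / (max_sw k)%:R.
Definition repr_ratio (k : nat) (W : {set C}) : R :=
  if max_cov k == 0%N then 1 else (cov W)%:R / (max_cov k)%:R.

Definition pay (b : 'I_n -> R) (c : C) (rho : R) : R :=
  \sum_(i in Nc c) Num.min (b i) rho.

Definition is_rho (b : 'I_n -> R) (c : C) (rho : R) : Prop :=
  0 <= rho /\ pay b c rho = 1 /\
  (forall r, 0 <= r -> pay b c r = 1 -> rho <= r).

Definition affordable (b : 'I_n -> R) (c : C) : Prop := exists rho, is_rho b c rho.

Definition update (b : 'I_n -> R) (c : C) (rho : R) : 'I_n -> R :=
  fun i => if i \in Nc c then b i - Num.min (b i) rho else b i.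

(* A tie-breaking rule: given the parameter k', the sequence of candidates
   selected so far and the (nonempty) set of tied candidates, pick one. *)
Definition tiebreak := nat -> seq C -> {set C} -> C.
Definition valid_tb (tb : tiebreak) : Prop :=
  forall k' s S, S != set0 -> tb k' s S \in S.

Definition tied (W : seq C) (b : 'I_n -> R) (rho : R) : {set C} :=
  [set c | `[< c \notin W /\ is_rho b c rho >]].

Inductive mes_run (tb : tiebreak) (k' : nat)
  : seq C -> ('I_n -> R) -> seq C -> Prop :=
| mes_stop W b :
    (forall c, c \notin W -> ~ affordable b c) -> mes_run tb k' W b W
| mes_go W b c rho W' :
    c \notin W -> is_rho b c rho ->
    (forall c' rho', c' \notin W -> is_rho b c' rho' -> rho <= rho') ->
    c = tb k' W (tied W b rho) ->
    mes_run tb k' (rcons W c) (update b c rho) W' ->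
    mes_run tb k' W b W'.

Definition mes_out (tb : tiebreak) (k' : nat) (W : {set C}) : Prop :=
  exists s, mes_run tb k' [::] (fun _ => k'%:R / n%:R) s /\ W = [set x in s].

Definition av_score (T : {set C}) : nat := (\sum_(c in T) #|Nc c|)%N.
Definition av_complete (k : nat) (W X : {set C}) : Prop :=
  exists T : {set C}, [disjoint T & W] /\ #|T| = (k - #|W|)%N /\
    (forall T' : {set C}, [disjoint T' & W] -> #|T'| = (k - #|W|)%N ->
       (av_score T' <= av_score T)%N) /\
    X = W :|: T.

Definition mes_vb (tb : tiebreak) (k : nat) (W : {set C}) : Prop :=
  (exists ks, (k <= ks)%N /\
     (forall k', (k <= k' < ks)%N -> forall W', mes_out tb k' W' -> (#|W'| < k)%N) /\
     exists W0, mes_out tb ks W0 /\ (k <= #|W0|)%N /\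
       (if #|W0| == k then W = W0 else mes_out tb ks.-1 W))
  \/
  ((forall k', (k <= k')%N -> forall W', mes_out tb k' W' -> (#|W'| < k)%N) /\
     mes_out tb k W).

Definition mes_vb_av (tb : tiebreak) (k : nat) (X : {set C}) : Prop :=
  exists W, mes_vb tb k W /\ av_complete k W X.

End MES.

(* Main.v *)
(* Lower bounds: let [x] be a candidate outside the committee with [s]
   supporters, let [k'] be the final parameter and [m] the integer part of
   [k' s / n]. The first [m] purchases have score at least [s], since [x] can be
   had at price [1/s] in these rounds; every purchase has price at most [k'/n],
   hence score at least [s/(m+1)]; and the AV completion only adds scores at
   least [s]. With the scores capped at [s], the committee therefore weighs at
   least [(m + (k-m)/(m+1)) s] if [m <= k], and [ks] otherwise, which by AM-GM is
   at least [(2 sqrt k - 2) s]. Take [s] maximal among the candidates outside the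
   committee: the optimum weighs at most [ks] after capping, and only members of
   the committee exceed the cap, so the ratio survives adding the excess back.
   The same facts give a committee member with at least [s] supporters for every
   such [x], which bounds the representation ratio.

   Tightness: in party-list profiles MES gives each party of [v] voters exactly
   the integer part of [k' v / n] seats, as long as its list is long enough. *)

Require Import Defs.
From HB Require Import structures.
From mathcomp Require Import all_boot all_order all_algebra.
From mathcomp Require Import boolp reals.
From mathcomp Require Import zify ring lra.
Set Implicit Arguments. Unset Strict Implicit. Unset Printing Implicit Defensive.
Import Order.TTheory GRing.Theory Num.Theory.
Local Open Scope ring_scope.

(** * Approval scores and the AV completion *)

Section Scores.
Context {C : finType} {n : nat} (A : 'I_n -> {set C}).

Lemma sw_av_score (W : {set C}) : sw A W = av_score A W.
Proof.
rewrite /sw /av_score.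
under eq_bigr => i _ do rewrite -sum1_card.
under [RHS]eq_bigr => c _ do rewrite -sum1_card.
rewrite [RHS](exchange_big_dep predT) //=; apply: eq_bigr => i _.
by apply: eq_bigl => c; rewrite !inE andbC.
Qed.

Lemma cov_le_sw (W : {set C}) : (cov A W <= sw A W)%N.
Proof.
rewrite /cov -sum1_card /sw [leqRHS](bigID (mem [set i | A i :&: W != set0])) /=.
apply: leq_trans (leq_addr _ _); apply: leq_sum => i.
by rewrite inE -card_gt0.
Qed.

Lemma card_Nc_le_cov (W : {set C}) c : c \in W -> (#|Nc A c| <= cov A W)%N.
Proof.
move=> cW; apply/subset_leq_card/subsetP => i; rewrite !inE => cAi.
by apply/set0Pn; exists c; rewrite inE cAi.
Qed.

(** Exchange argument: replacing [c] by [x] in the added set keeps its size, so maximality compares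
    just these two scores. *)
Lemma av_completeP k (W X : {set C}) : (#|W| <= k)%N -> av_complete A k W X ->
  [/\ W \subset X, #|X| = k &
   forall c x, c \in X :\: W -> x \notin X -> (#|Nc A x| <= #|Nc A c|)%N].
Proof.
move=> Wk [T [TW [cT [Tmax ->]]]]; split; first exact: subsetUl.
  rewrite cardsU setIC (disjoint_setI0 TW) cards0 subn0 cT; lia.
move=> c x; rewrite !inE => /andP[cW /orP[cinW|cT']].
  by rewrite cinW in cW.
rewrite negb_or => /andP[xW xT].
have := Tmax (x |: (T :\ c)).
rewrite /av_score big_setU1 /= ?inE ?(negPf xT) ?andbF //.
rewrite (big_setD1 c cT') /= leq_add2r; apply.
  rewrite -setI_eq0; apply/eqP/setP => y; rewrite !inE.
  have := disjointFr TW; case: (y =P x) => [->|_] /= TWf; first by rewrite (negPf xW).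
  by case: (boolP (y \in T)) => yT; rewrite ?(TWf _ yT) ?andbF.
by rewrite cardsU1 !inE (negPf xT) andbF /= -cT (cardsD1 c T) cT'.
Qed.

End Scores.

(** * Prices, budgets and scores along a run of MES *)

Section Runs.
Context {R : realType} {C : finType} {n : nat} (A : 'I_n -> {set C}).
Implicit Types (b : 'I_n -> R) (c x : C) (tb : tiebreak C).

Lemma is_rho_uniq b c r1 r2 : is_rho A b c r1 -> is_rho A b c r2 -> r1 = r2.
Proof.
move=> [p1 [e1 m1]] [p2 [e2 m2]]; apply/eqP; rewrite eq_le.
by rewrite m1 ?m2.
Qed.

Lemma pay_le b c r (B : R) : (forall i, Num.min (b i) r <= B) ->
  pay A b c r <= #|Nc A c|%:R * B.
Proof.
move=> le; rewrite mulr_natl -sumr_const; exact: ler_sum.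
Qed.

(** When every supporter can pay an equal share, equal shares sum to 1; at a lower price the
    supporters together pay less than 1. *)
Lemma is_rho_inv_card b c : (0 < #|Nc A c|)%N ->
  (forall i, i \in Nc A c -> #|Nc A c|%:R^-1 <= b i) ->
  is_rho A b c (#|Nc A c|%:R^-1).
Proof.
set s := #|Nc A c| => s0 bs; have s0R : 0 < s%:R :> R by rewrite ltr0n.
split; first by rewrite invr_ge0 ler0n.
split.
  rewrite /pay (eq_bigr (fun _ => s%:R^-1)); last first.
    by move=> i /bs; exact: min_r.
  by rewrite sumr_const -/s -[_ *+ s]mulr_natl divff // gt_eqF.
move=> r r0 pr; rewrite -[leLHS]mul1r ler_pdivrMr // -[leLHS]pr mulrC.
by apply: pay_le => i; rewrite ge_min lexx orbT.
Qed.

(** Invariant principle for runs. The tie-breaking choice is forgotten: [P] has to survive every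
    purchase at minimum price. *)
Lemma mes_run_inv tb k' (P : seq C -> ('I_n -> R) -> Prop) W b W' :
  (forall V d c rho, P V d -> c \notin V -> is_rho A d c rho ->
     (forall c' rho', c' \notin V -> is_rho A d c' rho' -> rho <= rho') ->
     P (rcons V c) (update A d c rho)) ->
  mes_run A tb k' W b W' -> P W b ->
  exists2 b', P W' b' & forall c, c \notin W' -> ~ affordable A b' c.
Proof.
move=> step; elim=> {W b W'} [W b stop PWb|W b c rho W' cW rhoc rhomin _ _ IH PWb].
  by exists b.
exact/IH/step.
Qed.

(** Each round selects a new candidate, so the number of unselected ones decreases. This supplies
    the runs of the tight instances. *)
Lemma mes_run_exists tb k' W b : valid_tb tb -> exists W', mes_run A tb k' W b W'.
Proof.
move=> tbP; have [N] := ubnP #|[set c | c \notin W]|.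
elim: N W b => // N IH W b leN.
have [stop|/existsNP[c0 /not_implyP[c0W /contrapT aff0]]] :=
    pselect (forall c, c \notin W -> ~ affordable A b c).
  by exists W; exact: mes_stop.
have /choice[f fP] : forall c, exists r, affordable A b c -> is_rho A b c r.
  move=> c; have [[r rP]|na] := pselect (affordable A b c); first by exists r.
  by exists 0.
pose P c := (c \notin W) && `[< affordable A b c >].
have P0 : P c0 by rewrite /P c0W; apply/asboolP.
have [c1 /andP[c1W /asboolP aff1] min1] := @arg_minP _ _ _ c0 P f P0.
pose c := tb k' W (tied A W b (f c1)).
have : c \in tied A W b (f c1).
  apply: tbP; apply/set0Pn; exists c1; rewrite inE; apply/asboolP.
  by split=> //; exact: fP.
rewrite inE => /asboolP[cW rhoc].
have [|W' runW'] := IH (rcons W c) (update A b c (f c1)).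
  rewrite (cardsD1 c) inE cW add1n ltnS in leN.
  apply: leq_ltn_trans leN; apply/subset_leq_card/subsetP => y.
  by rewrite !inE mem_rcons inE negb_or => /andP[-> ->].
exists W'; apply: mes_go runW' => // c' rho' c'W rho'P.
have aff' : affordable A b c' by exists rho'.
rewrite (is_rho_uniq rho'P (fP _ aff')); apply: min1.
by rewrite /P c'W; apply/asboolP.
Qed.

Lemma update_ge0 b c rho i : 0 <= b i -> 0 <= update A b c rho i.
Proof. by rewrite /update; case: ifP => // _ _; rewrite subr_ge0 ge_min lexx. Qed.

Lemma update_le b c rho i : 0 <= b i -> 0 <= rho -> update A b c rho i <= b i.
Proof.
by rewrite /update; case: ifP => // _ b0 r0; rewrite gerBl le_min b0.
Qed.

Lemma update_ge b c rho i : 0 <= rho -> b i - rho <= update A b c rho i.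
Proof.
rewrite /update; case: ifP => _ r0; last by rewrite gerBl.
by rewrite lerB // ge_min lexx orbT.
Qed.

Lemma sum_update b c rho :
  \sum_i update A b c rho i = \sum_i b i - pay A b c rho.
Proof.
rewrite /pay [X in _ - X]big_mkcond /= -sumrB; apply: eq_bigr => i _.
by rewrite /update; case: ifP => _; rewrite ?subr0.
Qed.

Lemma mes_run_uniq tb k' W b W' : mes_run A tb k' W b W' -> uniq W -> uniq W'.
Proof.
move=> run uW; have [|b'] // := mes_run_inv (P := fun V _ => uniq V) _ run uW.
by move=> V d c rho uV cV _ _; rewrite rcons_uniq cV.
Qed.

(** Each purchase takes exactly 1 out of the initial total [k'], and budgets stay nonnegative. *)
Lemma mes_run_size_le tb k' W' : (0 < n)%N ->
  mes_run A tb k' [::] (fun _ => k'%:R / n%:R : R) W' -> (size W' <= k')%N.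
Proof.
move=> n0 run; pose P (V : seq C) (d : 'I_n -> R) := (forall i, 0 <= d i) /\
  \sum_i d i + (size V)%:R = k'%:R :> R.
have [||b' [b'0 sumE] _] := mes_run_inv (P := P) _ run.
- move=> V d c rho [d0 sumd] _ [r0 [payE _]] _; split.
    by move=> i; apply: update_ge0.
  by rewrite sum_update payE size_rcons -sumd -natr1; ring.
- split; first by move=> i; rewrite divr_ge0.
  rewrite sumr_const card_ord addr0 -[_ *+ n]mulr_natr divfK //.
  by rewrite pnatr_eq0 -lt0n.
rewrite -(ler_nat R) -sumE lerDr.
by apply: sumr_ge0 => i _.
Qed.

Lemma is_rho_card_ge b c rho (B : R) : is_rho A b c rho ->
  (forall i, Num.min (b i) rho <= B) -> 1 <= #|Nc A c|%:R * B.
Proof. by move=> [_ [p1 _]]; rewrite -[X in X <= _]p1; exact: pay_le. Qed.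

(* While every budget is at least [1/s], where [s] counts the supporters of [x],
   the price of [x] is [1/s]; a round lowers each budget by at most [1/s], so
   this holds for the first [m] rounds. Later prices are at most [k'/n]. *)
Lemma mes_run_scores tb k' W x (s := #|Nc A x|) (m := (k' * s %/ n)%N) :
    (0 < n)%N -> mes_run A tb k' [::] (fun _ => k'%:R / n%:R : R) W ->
    x \notin W -> (0 < s)%N ->
  (minn (size W) m <= count (fun c => s <= #|Nc A c|)%N W)%N /\
  (forall c, c \in W -> (s <= #|Nc A c| * m.+1)%N).
Proof.
move=> n0 run xW s0; pose B : R := k'%:R / n%:R.
have n0R : 0 < n%:R :> R by rewrite ltr0n.
have s0R : 0 < s%:R :> R by rewrite ltr0n.
have mB : m%:R / s%:R <= B.
  rewrite /B ler_pdivrMr // mulrAC ler_pdivlMr // -!natrM ler_nat.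
  exact: leq_divM.
have Bm : B * s%:R <= m.+1%:R.
  rewrite /B mulrAC ler_pdivrMr // -!natrM ler_nat.
  exact/ltnW/ltn_ceil.
pose P (V : seq C) (d : 'I_n -> R) := [/\ forall i, 0 <= d i <= B,
  (forall c, c \in V -> (s <= #|Nc A c| * m.+1)%N) &
  x \notin V ->
    (minn (size V) m <= count (fun c => s <= #|Nc A c|)%N V)%N /\
    ((size V <= m)%N -> forall i, B - (size V)%:R / s%:R <= d i)].
have [||b' [_ scoreW /(_ xW)[cntW _]] _] // := mes_run_inv (P := P) _ run.
- move=> V d c rho [d0B scoreV xV] cV rhoP rhomin; have [rho0 _] := rhoP.
  have d0 i : 0 <= d i by case/andP: (d0B i).
  have dB i : d i <= B by case/andP: (d0B i).
  split.
  + move=> i; rewrite update_ge0 //=; exact: le_trans (update_le _ _ _) (dB i).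
  + move=> c'; rewrite mem_rcons inE => /orP[/eqP->|/scoreV //].
    have : 1 <= #|Nc A c|%:R * B.
      by apply: (is_rho_card_ge rhoP) => i; rewrite ge_min dB.
    rewrite -(ler_pM2r s0R) mul1r -mulrA => /le_trans le.
    by rewrite -(ler_nat R) natrM; apply: le; apply: ler_wpM2l.
  rewrite mem_rcons inE negb_or => /andP[_ xnV].
  have [cnt bud] := xV xnV.
  rewrite size_rcons -cats1 count_cat /= addn0.
  have [ltm|gem] := ltnP (size V) m; last first.
    split=> //.
    apply: leq_trans (leq_trans cnt (leq_addr _ _)).
    by rewrite (minn_idPr gem) (minn_idPr (leqW gem)).
  have rhox : is_rho A d x (s%:R^-1).
    apply: is_rho_inv_card => // i _; apply: le_trans (bud (ltnW ltm) i).
    rewrite lerBrDl; apply: le_trans mB.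
    by rewrite -[X in _ + X]mul1r -mulrDl ler_pM2r ?invr_gt0 // natr1 ler_nat.
  have rhole := rhomin _ _ xnV rhox.
  have sc : (s <= #|Nc A c|)%N.
    have : 1 <= #|Nc A c|%:R * (s%:R^-1 : R).
      by apply: (is_rho_card_ge rhoP) => i; rewrite ge_min rhole orbT.
    by rewrite ler_pdivlMr // mul1r ler_nat.
  split; first by rewrite sc addn1 (minn_idPl ltm) ltnS -(minn_idPl (ltnW ltm)).
  move=> _ i; apply: le_trans (update_ge _ _ _ rho0).
  apply: le_trans (lerB (bud (ltnW ltm) i) rhole).
  by rewrite -natr1 mulrDl mul1r opprD addrA.
- split=> //; last first.
    by move=> _; rewrite min0n; split=> // _ i; rewrite mul0r subr0.
  by move=> i; rewrite divr_ge0 ?lexx.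
Qed.

(** * From a single run to the completed committee *)

Lemma mes_vb_run tb k W : (0 < n)%N -> mes_vb R A tb k W ->
  exists k' s, [/\ mes_run A tb k' [::] (fun _ => k'%:R / n%:R : R) s,
                  W = [set x in s] & (#|W| <= k)%N].
Proof.
move=> n0.
have sizeW k' V : mes_out R A tb k' V -> (#|V| <= k')%N.
  move=> [s [run ->]]; rewrite cardsE.
  exact: leq_trans (card_size _) (mes_run_size_le n0 run).
have found k' V : mes_out R A tb k' V -> (#|V| <= k)%N -> exists k' s,
    [/\ mes_run A tb k' [::] (fun _ => k'%:R / n%:R : R) s,
        V = [set x in s] & (#|V| <= k)%N].
  by move=> [s [run VE]] Vk; exists k', s.
case=> [[ks [kks [lt_k [W0 [out0 [kW0]]]]]]|[_ out]]; last first.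
  exact: found out (sizeW _ _ out).
case: eqP => [W0k ->|W0k out]; first by apply: found out0 _; rewrite W0k.
apply: (found _ _ out); apply/ltnW/(lt_k _ _ _ out).
(* Here [k < #|W0| <= ks], so [ks.-1] is still at least [k] and lies in the range where fewer than
   [k] candidates are selected. *)
have := sizeW _ _ out0; lia.
Qed.

(** Transfers the score bounds from the run to [X]: members added by AV all score at least [s],
    because AV passed over [x]. *)
Lemma mes_vb_av_scores tb k X x (s := #|Nc A x|) :
    (0 < n)%N -> mes_vb_av R A tb k X -> x \notin X -> (0 < s)%N ->
  exists2 m, (minn m k <= #|[set c in X | s <= #|Nc A c|]|)%N &
    forall c, c \in X -> (s <= #|Nc A c| * m.+1)%N.
Proof.
move=> n0 [W [/(mes_vb_run n0)[k' [w [run WE Wk]]] /(av_completeP Wk)]].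
move=> [WX cX TX] xX s0.
have memW c : (c \in W) = (c \in w) by rewrite WE inE.
have xw : x \notin w by rewrite -memW; apply: contra xX; exact/subsetP.
have uw := mes_run_uniq run isT.
have szw : size w = #|W| by rewrite WE cardsE (card_uniqP uw).
have [cnt scw] := mes_run_scores n0 run xw s0.
exists (k' * s %/ n)%N => [|c cinX]; last first.
  have [/scw //|cw] := boolP (c \in w).
  apply: leq_trans (leq_pmulr _ _) => //; apply: TX => //.
  by rewrite inE memW cw.
set S := [set c in X | _].
have SW : (count (fun c => s <= #|Nc A c|)%N w <= #|S :&: W|)%N.
  rewrite -size_filter -(card_uniqP (filter_uniq _ uw)).
  apply/subset_leq_card/subsetP => c; rewrite mem_filter !inE memW.
  by move=> /andP[-> cw]; rewrite cw (subsetP WX) // memW.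
have SD : S :\: W = X :\: W.
  apply/setP => c; rewrite !inE; case: (boolP (c \in W)) => //= cW.
  by case: (boolP (c \in X)) => //= cinX; apply: TX => //; rewrite inE cW.
have := cardsID W S; have := cardsID W X; rewrite SD cX (setIidPr WX).
move: cnt; rewrite szw; move: (_ %/ n)%N (count _ _) #|S| #|S :&: W| #|_ :\: _| SW => m.
by move: #|W| Wk; lia.
Qed.

Lemma mes_vb_av_card tb k X : (0 < n)%N -> mes_vb_av R A tb k X -> #|X| = k.
Proof. by move=> n0 [W [/(mes_vb_run n0)[k' [w [_ _ Wk]]] /(av_completeP Wk)[]]]. Qed.

Lemma mes_vb_av_cov tb k X c : (0 < n)%N -> (0 < k)%N -> mes_vb_av R A tb k X ->
  (#|Nc A c| <= cov A X)%N.
Proof.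
move=> n0 k0 out; have [/card_Nc_le_cov //|cX] := boolP (c \in X).
have [->//|s0] := posnP #|Nc A c|.
suff [d dX le] : exists2 d, d \in X & (#|Nc A c| <= #|Nc A d|)%N.
  exact: leq_trans le (card_Nc_le_cov _ dX).
have [m cnt sc] := mes_vb_av_scores n0 out cX s0.
have [m0|m0] := posnP m.
  have : (0 < #|X|)%N by rewrite (mes_vb_av_card n0 out).
  by case/card_gt0P => d dX; exists d => //; have := sc d dX; rewrite m0 muln1.
have : (0 < minn m k)%N by rewrite leq_min m0.
by move/leq_trans => /(_ _ cnt)/card_gt0P[d]; rewrite inE => /andP[]; exists d.
Qed.

(** * Lower bounds on the two ratios *)

Lemma repr_ratio_ge tb k X : (0 < n)%N -> (0 < k)%N -> mes_vb_av R A tb k X ->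
  1 / k%:R <= repr_ratio R A k X.
Proof.
move=> n0 k0 out; rewrite /repr_ratio; case: eqP => [_|/eqP M0].
  by rewrite ler_pdivrMr ?ltr0n // mul1r ler1n.
rewrite ler_pdivrMr ?ltr0n // mulrAC ler_pdivlMr ?ltr0n ?lt0n // mul1r.
rewrite -natrM ler_nat; apply/bigmax_leqP => V /eqP cV.
(* The coverage of [V] is at most the sum of its [k] scores, each of which is at most the coverage
   of [X]. *)
apply: leq_trans (cov_le_sw _ _) _; rewrite sw_av_score -cV mulnC -sum_nat_const.
by apply: leq_sum => c _; exact: (mes_vb_av_cov _ n0 k0 out).
Qed.

(* With [u] for the square root of [k], this is [(m + 1 - u)^2 >= 0] when
   [m <= k], and [(u - 1)^2 >= 0] otherwise. *)
Lemma sqrt_bound (k m : nat) :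
  (m.+1%:R : R) * (2 * Num.sqrt k%:R - 2) <= (k + m * minn m k)%:R.
Proof.
set u : R := Num.sqrt k%:R.
have uu : k%:R = u ^+ 2 by rewrite sqr_sqrtr.
have [mk|km] := leqP m k.
  rewrite natrD natrM -natr1 uu -subr_ge0.
  have := sqr_ge0 (m%:R + 1 - u); nra.
rewrite -mulSn natrM ler_pM2l ?ltr0n // uu.
have := sqr_ge0 (u - 1); nra.
Qed.

Lemma sum_minn_score_ge tb k X x (s := #|Nc A x|) :
    (0 < n)%N -> mes_vb_av R A tb k X -> x \notin X ->
  (2 * Num.sqrt k%:R - 2) * s%:R <= (\sum_(c in X) minn #|Nc A c| s)%:R :> R.
Proof.
move=> n0 out xX; have [s0|s0] := posnP s; first by rewrite s0 mulr0.
have [m cnt sc] := mes_vb_av_scores n0 out xX s0.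
have cX := mes_vb_av_card n0 out.
rewrite -(@ler_pM2l _ m.+1%:R) ?ltr0n // mulrA.
apply: le_trans (ler_wpM2r (ler0n _ _) (sqrt_bound k m)) _.
rewrite -!natrM ler_nat big_distrr /=.
set S := [set c in X | _] in cnt.
have SX : S \subset X by apply/subsetP => c; rewrite inE => /andP[].
(* After scaling by [m.+1], members of [S] count [m.+1 * s] each and the others at least [s]: in
   total [k * s] plus [m * s] for each member of [S]. *)
rewrite (bigID (mem S)) /= mulnDl addnC.
have -> : (k * s = \sum_(c in X | c \in S) s + \sum_(c in X | c \notin S) s)%N.
  by rewrite -cX -sum_nat_const (bigID (mem S)).
rewrite addnA leq_add //; last first.
  apply: leq_sum => c /andP[/sc le _]; rewrite minnMr leq_min mulnC le mulnC.
  exact: leq_pmulr.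
have memS c : (c \in X) && (c \in S) = (c \in S).
  by rewrite andb_idl // => /(subsetP SX).
rewrite !(eq_bigl _ _ memS).
rewrite [leqRHS](eq_bigr (fun=> m.+1 * s)%N); last first.
  by move=> c; rewrite inE => /andP[_ le]; rewrite (minn_idPr le).
rewrite !sum_nat_const mulSn mulnDr addnC leq_add2l.
by rewrite -mulnA mulnCA leq_mul2r cnt orbT.
Qed.

(** No candidate outside [X] exceeds the cap [s], so the excess over [X] is the excess over all
    candidates, and it dominates that of any competitor. *)
Lemma max_sw_le k (X : {set C}) (s := \max_(c | c \notin X) #|Nc A c|) :
  (max_sw A k <= k * s + \sum_(c in X) (#|Nc A c| - s))%N.
Proof.
apply/bigmax_leqP => V /eqP cV; rewrite sw_av_score -cV -sum_nat_const.
have -> : (\sum_(c in X) (#|Nc A c| - s) = \sum_c (#|Nc A c| - s))%N.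
  rewrite [RHS](bigID (mem X)) /= [X in _ = (_ + X)%N]big1 ?addn0 // => c cX.
  by apply/eqP; rewrite subn_eq0; exact: leq_bigmax_cond.
rewrite [X in (_ <= _ + X)%N](bigID (mem V)) /= addnA -big_split /=.
apply: leq_trans (leq_addr _ _).
by apply: leq_sum => c _; rewrite -leq_subLR.
Qed.

Lemma sqrt_ratio (k : nat) : (0 < k)%N ->
  2 / Num.sqrt (k%:R : R) - 2 / k%:R = (2 * Num.sqrt k%:R - 2) / k%:R.
Proof.
move=> k0; have : 0 < Num.sqrt (k%:R : R) by rewrite sqrtr_gt0 ltr0n.
have := sqr_sqrtr (ler0n R k); move: (Num.sqrt _) => u <- /gt_eqF/negbT u0.
by field.
Qed.

Lemma util_ratio_ge tb k X : (0 < n)%N -> (0 < k)%N -> mes_vb_av R A tb k X ->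
  2 / Num.sqrt (k%:R : R) - 2 / k%:R <= util_ratio R A k X.
Proof.
move=> n0 k0 out; rewrite sqrt_ratio //; set r := _ / _.
have k0R : 0 < k%:R :> R by rewrite ltr0n.
have r1 : r <= 1.
  rewrite ler_pdivrMr // mul1r -[leRHS]sqr_sqrtr ?ler0n //.
  have := sqr_ge0 (Num.sqrt k%:R - 1 : R); nra.
rewrite /util_ratio; case: eqP => // /eqP M0.
rewrite ler_pdivlMr ?ltr0n ?lt0n //.
have [r0|r0] := ltP r 0.
  by apply: le_trans (ler0n _ _); rewrite mulr_le0_ge0 // ltW.
have := max_sw_le k X; set s := \max_(c | _) _ => maxle.
set E := (\sum_(c in X) (#|Nc A c| - s))%N in maxle.
pose M := (\sum_(c in X) minn #|Nc A c| s)%N.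
have swX : sw A X = (M + E)%N.
  rewrite sw_av_score /M /E -big_split; apply: eq_bigr => c _ /=.
  by rewrite minnE subnK // leq_subr.
have Mge : r * (k%:R * s%:R) <= M%:R.
  rewrite mulrA divfK ?gt_eqF //.
  (* The case [s = 0] includes an empty complement of [X], where the maximum defaults to 0. *)
  have [s0|s0] := posnP s; first by rewrite s0 mulr0.
  have [x xX sE] : exists2 x, x \notin X & s = #|Nc A x|.
    have : (0 < #|[pred c | c \notin X]|)%N.
      rewrite lt0n; apply: contraL s0 => /eqP/card0_eq e.
      by rewrite /s big_pred0 // => c; have := e c; rewrite inE.
    move=> /(eq_bigmax_cond (fun c => #|Nc A c|))[x]; rewrite inE => xX ?.
    by exists x.
  by rewrite /M sE; exact: sum_minn_score_ge out xX.
apply: le_trans (ler_wpM2l r0 (_ : _ <= (k * s + E)%:R)) _; first by rewrite ler_nat.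
rewrite swX !natrD natrM mulrDr lerD //.
(* The excess [E] occurs on both sides, scaled by [r <= 1] on the left only. *)
by rewrite ler_piMl.
Qed.

End Runs.

(** * Tightness on party-list profiles *)

Lemma valid_tb_exists (C : finType) : C -> exists tb : tiebreak C, valid_tb tb.
Proof.
move=> c0; exists (fun _ _ (S : {set C}) => odflt c0 [pick c in S]) => _ _ S /set0Pn[c cS].
by case: pickP => //= /(_ c); rewrite cS.
Qed.

Section PartyLists.
Context {n : nat} (k : nat) (p : 'I_n -> 'I_n).
Notation C := ('I_n * 'I_k)%type.

(** Candidate [(a, j)] is entry [j] on the list of party [a]. Parties are indexed like voters, so
    some may have no supporters. *)
Definition party_profile (i : 'I_n) : {set C} := [set c | c.1 == p i].
Definition party_size (a : 'I_n) : nat := #|[set i | p i == a]|.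
Definition seats (X : {set C}) (a : 'I_n) : nat := #|[set c in X | c.1 == a]|.

Lemma card_Nc_party c : #|Nc party_profile c| = party_size c.1.
Proof. by congr #|pred_of_set _|; apply/setP => i; rewrite !inE eq_sym. Qed.

Lemma sum_party_size : (\sum_a party_size a)%N = n.
Proof.
rewrite -[RHS]card_ord -sum1_card [RHS](partition_big p predT) //=.
by apply: eq_bigr => a _; rewrite /party_size -sum1_card; apply: eq_bigl => i; rewrite inE.
Qed.

Lemma sum_seats (X : {set C}) : (\sum_a seats X a)%N = #|X|.
Proof.
rewrite -sum1_card [RHS](partition_big fst predT) //=.
by apply: eq_bigr => a _; rewrite /seats -sum1_card; apply: eq_bigl => c; rewrite inE.
Qed.

Lemma sw_party (X : {set C}) : sw party_profile X = (\sum_i seats X (p i))%N.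
Proof.
by apply: eq_bigr => i _; congr #|pred_of_set _|; apply/setP => c; rewrite !inE andbC.
Qed.

(** Members of a party always hold equal budgets, so each seat costs them 1 in equal shares out of
    their total [q]. The condition [q <= k] keeps the list from running out too early. *)
Lemma party_out_seats (R : realType) tb k' X a (q := k'%:R / n%:R * (party_size a)%:R : R) :
    mes_out R party_profile tb k' X -> q <= k%:R ->
  (seats X a)%:R <= q < (seats X a).+1%:R.
Proof.
move=> [W [run ->]] qk; set B : R := k'%:R / n%:R in run q qk *.
pose cnt (V : seq C) := count (fun c => c.1 == a) V.
have uW := mes_run_uniq run isT.
have -> : seats [set c in W] a = cnt W.
  rewrite /cnt -size_filter -(card_uniqP (filter_uniq _ uW)).
  by apply: eq_card => c; rewrite mem_filter !inE andbC.
pose s := party_size a; pose e V : R := B - (cnt V)%:R / s%:R.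
(* For a party without voters the budget clause is vacuous, hence the separate record that it wins
   no seat. *)
pose P (V : seq C) (d : 'I_n -> R) :=
  (forall i, p i = a -> d i = e V /\ 0 <= d i) /\ (s = 0%N -> cnt V = 0%N).
have [||b [bE cnt0] stop] := mes_run_inv (P := P) _ run.
- move=> V d c rho [dE cnt0] _ [rho0 [payE _]] _.
  have cntE : cnt (rcons V c) = (cnt V + (c.1 == a))%N.
    by rewrite /cnt -cats1 count_cat /= addn0.
  have [ca|ca] := eqVneq c.1 a; last first.
    rewrite /P /e cntE (negPf ca) addn0; split=> // i pia.
    by rewrite /update !inE pia (negPf ca); exact: dE.
  have cNc i : (i \in Nc party_profile c) = (p i == a) by rewrite !inE ca eq_sym.
  have : s%:R * Num.min (e V) rho = 1.
    rewrite -[RHS]payE /pay (eq_bigr (fun=> Num.min (e V) rho)); last first.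
      by move=> i; rewrite cNc => /eqP/dE[-> _].
    by rewrite sumr_const mulr_natl card_Nc_party ca.
  have [->|s0] := posnP s; first by rewrite mul0r => /eqP; rewrite eq_sym oner_eq0.
  have sn0 : s%:R != 0 :> R by rewrite pnatr_eq0 -lt0n.
  move=> /(canRL (mulKf sn0)); rewrite mulr1 => minE.
  split=> [i pia|sE]; last by rewrite sE in s0.
  split; last by apply: update_ge0; case: (dE i pia).
  rewrite /update cNc pia eqxx; have [-> _] := dE i pia.
  by rewrite minE /e cntE ca eqxx addn1 -natr1 mulrDl mul1r opprD addrA.
- split=> // i _; split; first by rewrite /e mul0r subr0.
  by rewrite divr_ge0.
have [s0|s0] := posnP s; first by rewrite cnt0 // /q -/s s0 mulr0 lexx ltr01.
have s0R : 0 < s%:R :> R by rewrite ltr0n.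
have eE : e W * s%:R = q - (cnt W)%:R by rewrite mulrBl divfK ?gt_eqF.
apply/andP; split.
  have /card_gt0P[i] := s0; rewrite inE => /eqP/bE[-> e0].
  by rewrite -subr_ge0 -eE mulr_ge0.
(* If the party had at least 1 left, it could still afford an unselected entry of its list,
   contradicting the stopping condition. *)
rewrite ltNge; apply/negP => le.
have ltk : (cnt W < k)%N by rewrite -(ler_nat R); exact: le_trans le qk.
have [j jW] : exists j, (a, j) \notin W.
  apply/existsP; apply: contraTT ltk; rewrite negb_exists -leqNgt => /forallP allW.
  rewrite -[X in (X <= _)%N]card_ord cardE -(size_map (pair a)) /cnt -size_filter.
  apply: uniq_leq_size; first by rewrite map_inj_uniq ?enum_uniq // => ? ? [].
  move=> c /mapP[j _ ->]; rewrite mem_filter /= eqxx /=.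
  by have := allW j; rewrite negbK.
apply: (stop (a, j) jW); exists (#|Nc party_profile (a, j)|%:R^-1).
apply: is_rho_inv_card => [|i]; first by rewrite card_Nc_party.
rewrite !inE /= => /eqP/esym pia; have [-> _] := bE i pia.
rewrite card_Nc_party /= -/s -[leLHS]mul1r ler_pdivrMr // eE lerBrDl.
by rewrite natr1.
Qed.

End PartyLists.

(* One supporter per party: a budget below 1 buys nothing, and a budget of 1
   buys one candidate of each of the [k + 1] parties. *)
Lemma repr_tight (R : realType) (k : nat) : (0 < k)%N ->
  exists (C : finType) (n : nat) (A : 'I_n -> {set C}) (tb : tiebreak C)
         (X : {set C}),
    (0 < n)%N /\ (1 <= k <= #|C|)%N /\ valid_tb tb /\
    mes_vb_av R A tb k X /\ repr_ratio R A k X <= 1 / k%:R.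
Proof.
move=> k0; pose C := ('I_k.+1 * 'I_k)%type; pose A := party_profile k (@id 'I_k.+1).
have [tb tbP] := valid_tb_exists ((ord0, Ordinal k0) : C).
pose X : {set C} := [set c | c.1 == ord0].
have size1 a : party_size (@id 'I_k.+1) a = 1%N.
  by rewrite -(cards1 a); congr #|pred_of_set _|; apply/setP => i; rewrite !inE.
have scoreE (T : {set C}) : av_score A T = #|T|.
  by rewrite -sum1_card; apply: eq_bigr => c _; rewrite card_Nc_party size1.
have k1R : 0 < k.+1%:R :> R by rewrite ltr0n.
have outE k' W : (k' <= k.+1)%N -> mes_out R A tb k' W ->
    #|W| = (if k' == k.+1 then k.+1 else 0)%N.
  move=> k'k out; rewrite -sum_seats.
  have seatE a : seats W a = (k' == k.+1).
    have := party_out_seats (a := a) out; rewrite size1 mulr1 => /(_ _)/andP[].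
      rewrite ler_pdivrMr // -natrM ler_nat; exact: leq_trans k'k (leq_pmull _ _).
    rewrite ler_pdivlMr // ltr_pdivrMr // -!natrM ler_nat ltr_nat.
    case: (seats W a) => [|[|j]]; case: eqP; nia.
  under eq_bigr do rewrite seatE.
  by rewrite sum_nat_const card_ord; case: eqP => _; rewrite ?muln1 ?muln0.
have card_slice (f : 'I_k.+1 * 'I_k -> bool) (g : 'I_k -> C) :
    injective g -> (forall c, f c = (c \in codom g)) -> #|[set c | f c]| = k.
  move=> gI fE; rewrite -[RHS](card_ord k) -(card_codom gI).
  by apply: eq_card => c; rewrite !inE fE.
have cX : #|X| = k.
  apply: (card_slice _ (pair ord0)) => [? ? [] //|[a j]] /=.
  apply/eqP/codomP => [->|[j' [-> _]] //]; by exists j.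
exists C, k.+1, A, tb, X; split=> //; split.
  by rewrite k0 card_prod !card_ord leq_pmull.
split=> //; split.
  have [s0 run0] := mes_run_exists A k [::] (fun=> k%:R / k.+1%:R : R) tbP.
  have [s1 run1] := mes_run_exists A k.+1 [::] (fun=> k.+1%:R / k.+1%:R : R) tbP.
  have out0 : mes_out R A tb k [set c in s0] by exists s0.
  have out1 : mes_out R A tb k.+1 [set c in s1] by exists s1.
  have c0 := outE _ _ (leqnSn k) out0; rewrite ltn_eqF // in c0.
  have c1 := outE _ _ (leqnn _) out1; rewrite eqxx in c1.
  have s0E := cards0_eq c0.
  (* Parameter [k.+1] overshoots by one, so the empty output at [k] is kept. All scores being 1, AV
     may then add any [k] candidates, in particular all those of one party. *)
  exists set0; split.
    left; exists k.+1; split; first exact: leqnSn.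
    split=> [k' kk' W' outW'|].
      have kE : k' = k by lia.
      by rewrite (outE _ _ _ outW') kE ?ltn_eqF.
    exists [set c in s1]; rewrite c1 leqnSn gtn_eqF //.
    by split=> //; split=> //; rewrite -s0E.
  exists X; rewrite cards0 subn0 set0U -setI_eq0 setI0; split=> //.
  by split=> //; split=> // T' _ cT'; rewrite !scoreE cT' cX.
(* A competitor with one candidate from each of [k] parties, covering [k] voters. *)
pose V : {set C} := [set c | c.1 == widen_ord (leqnSn k) c.2].
have cV : #|V| = k.
  apply: (card_slice _ (fun j => (widen_ord (leqnSn k) j, j))).
    by move=> ? ? [].
  move=> [a j] /=; apply/eqP/codomP => [->|[j' [-> ->]] //]; by exists j.
have covV : (k <= cov A V)%N.
  rewrite -[X in (X <= _)%N]card_ord -(card_codom (f := widen_ord (leqnSn k))).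
    apply/subset_leq_card/subsetP => i /codomP[j ->]; rewrite inE.
    by apply/set0Pn; exists (widen_ord (leqnSn k) j, j); rewrite !inE !eqxx.
  by move=> i j /(congr1 val) /= /val_inj.
have maxk : (k <= max_cov A k)%N.
  by apply: leq_trans covV _; apply: leq_bigmax_cond; rewrite cV.
have covX : (cov A X <= 1)%N.
  rewrite -(cards1 (ord0 : 'I_k.+1)); apply/subset_leq_card/subsetP => i.
  rewrite !inE => /set0Pn[c]; rewrite !inE => /andP[/eqP <-].
  by [].
rewrite /repr_ratio gtn_eqF ?(leq_trans k0) //.
rewrite ler_pdivrMr ?ltr0n ?(leq_trans k0) // mulrAC mul1r.
rewrite ler_pdivlMr ?ltr0n // -natrM ler_nat (leq_trans _ maxk) //.
by rewrite -[leqRHS]mul1n leq_mul2r covX orbT.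
Qed.

(* The first [r] voters form one party, every other voter is alone: a budget of
   1 buys [r] candidates of score [r] and [r * r] candidates of score 1. *)
Lemma util_tight (R : realType) (r k : nat) : (0 < r)%N -> k = (r * r + r)%N ->
  exists (C : finType) (n : nat) (A : 'I_n -> {set C}) (tb : tiebreak C)
         (X : {set C}),
    (0 < n)%N /\ (1 <= k <= #|C|)%N /\ valid_tb tb /\
    mes_vb_av R A tb k X /\ util_ratio R A k X <= 2 / Num.sqrt (k%:R : R).
Proof.
move=> r0 kE; have k0 : (0 < k)%N by lia.
pose o : 'I_k := Ordinal k0.
pose p (i : 'I_k) : 'I_k := if (i < r)%N then o else i.
pose C := ('I_k * 'I_k)%type; pose A := party_profile k p.
have [tb tbP] := valid_tb_exists ((o, o) : C).
have rk : (r <= k)%N by lia.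
have card_lt : #|[set i : 'I_k | (i < r)%N]| = r.
  rewrite -[RHS](card_ord r) -(card_codom (f := widen_ord rk)); last first.
    by move=> i j /(congr1 val) /= /val_inj.
  apply: eq_card => i; rewrite inE; apply/idP/codomP => [ir|[j ->] /=]; last exact: ltn_ord.
  by exists (Ordinal ir); apply: val_inj.
have p_o i : (p i == o) = (i < r)%N.
  rewrite /p; case: ifP => [_|ir]; first exact: eqxx.
  by apply/eqP => io; rewrite io r0 in ir.
have size_o : party_size p o = r.
  by rewrite -[RHS]card_lt; congr #|pred_of_set _|; apply/setP => i; rewrite !inE p_o.
have size1 (i : 'I_k) : (i < r)%N = false -> party_size p i = 1%N.
  move=> ir; rewrite -(cards1 i); congr #|pred_of_set _|; apply/setP => j.
  rewrite !inE /p; case: ifP => // jr; apply/eqP/eqP => ij; last by rewrite ij ir in jr.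
  by rewrite -ij r0 in ir.
have size_le a : (party_size p a <= k)%N.
  by rewrite -[X in (_ <= X)%N](card_ord k) max_card.
have seatE X a : mes_out R A tb k X -> seats X a = party_size p a.
  move=> out; have kk : k%:R / k%:R = 1 :> R by rewrite divff // pnatr_eq0 -lt0n.
  have := party_out_seats (a := a) out; rewrite kk mul1r !ler_nat ltr_nat.
  move=> /(_ (size_le a)); lia.
have [s run] := mes_run_exists A k [::] (fun=> k%:R / k%:R : R) tbP.
set X := [set c in s]; have out : mes_out R A tb k X by exists s.
have cX : #|X| = k.
  by rewrite -sum_seats -[RHS](sum_party_size p); apply: eq_bigr => a _; exact: seatE.
exists C, k, A, tb, X; split=> //; split.
  by rewrite k0 card_prod !card_ord leq_pmull.
split=> //; split.
  (* Already parameter [k] selects exactly [k] candidates, so AV adds nothing. *)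
  exists X; split.
    left; exists k; split=> //; split=> [k' ?|]; first lia.
    by exists X; rewrite cX eqxx leqnn.
  exists set0; rewrite -setI_eq0 set0I cards0 cX subnn setU0; split=> //; split=> //.
  by split=> // T' _ /cards0_eq->.
have split_sum (f g : nat) :
    (\sum_(i < k) (if (i < r)%N then f else g) = r * f + r * r * g)%N.
  rewrite big_if /= !sum_nat_cond_const; congr (_ * _ + _ * _)%N.
    by rewrite -[RHS]card_lt; apply: eq_card => i; rewrite !inE.
  have := cardsC [set i : 'I_k | (i < r)%N]; rewrite card_lt card_ord => c.
  apply: (@addnI r); rewrite [RHS]addnC -kE -[RHS]c; congr (_ + _)%N.
  by apply: eq_card => i; rewrite !inE.
have swX : sw A X = (2 * (r * r))%N.
  rewrite sw_party (eq_bigr (fun i : 'I_k => if (i < r)%N then r else 1%N)).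
    by rewrite split_sum; lia.
  by move=> i _; rewrite seatE // /p; case: ifP => // /size1.
(* The competitor takes the whole list of the large party and has welfare [r * k], against
   [2 * (r * r)] for [X]. The ratio is [2 / r.+1], and [k <= r.+1 ^ 2]. *)
pose V : {set C} := [set c | c.1 == o].
have seatV : seats V o = k.
  rewrite -[RHS](card_ord k) -(card_codom (f := pair o)); last by move=> ? ? [].
  apply: eq_card => [[a j]]; rewrite !inE /= andbb.
  by apply/eqP/codomP => [->|[j' [-> _]] //]; exists j.
have cV : #|V| = k.
  by rewrite -[RHS]seatV; apply: eq_card => c; rewrite !inE andbb.
have max_ge : (r * k <= max_sw A k)%N.
  apply: (@leq_trans (sw A V)); last by apply: leq_bigmax_cond; rewrite cV.
  have -> : (r * k = \sum_(i < k) (if (i < r) then k else 0))%N.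
    by rewrite split_sum muln0 addn0.
  rewrite sw_party.
  by apply: leq_sum => i _; rewrite /p; case: ifP => // _; rewrite seatV.
have rk0 : (0 < r * k)%N by rewrite muln_gt0 r0.
rewrite /util_ratio gtn_eqF ?(leq_trans rk0) // swX.
have u0 : 0 < Num.sqrt (k%:R : R) by rewrite sqrtr_gt0 ltr0n.
rewrite ler_pdivrMr ?ltr0n ?(leq_trans rk0) // mulrAC ler_pdivlMr //.
have ule : Num.sqrt (k%:R : R) <= r.+1%:R.
  rewrite -[leRHS]ger0_norm // -sqrtr_sqr ler_wsqrtr // -natrX ler_nat kE; nia.
apply: le_trans (_ : (2 * (r * r))%:R * r.+1%:R <= _); first by rewrite ler_wpM2l.
rewrite -!natrM ler_nat; apply: leq_trans (leq_mul (leqnn 2) max_ge); nia.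
Qed.

Theorem theorem9 (R : realType) :
  (forall (C : finType) (n : nat) (A : 'I_n -> {set C}) (k : nat)
          (tb : tiebreak C) (X : {set C}),
      (0 < n)%N -> (1 <= k <= #|C|)%N -> valid_tb tb ->
      mes_vb_av R A tb k X ->
      1 / k%:R <= repr_ratio R A k X /\
      2 / Num.sqrt (k%:R : R) - 2 / k%:R <= util_ratio R A k X)
  /\
  (exists K : R, 0 < K /\
    forall m : nat, exists k : nat, (m <= k)%N /\
      (exists (C : finType) (n : nat) (A : 'I_n -> {set C}) (tb : tiebreak C)
              (X : {set C}),
         (0 < n)%N /\ (1 <= k <= #|C|)%N /\ valid_tb tb /\
         mes_vb_av R A tb k X /\ repr_ratio R A k X <= K / k%:R) /\
      (exists (C : finType) (n : nat) (A : 'I_n -> {set C}) (tb : tiebreak C)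
              (X : {set C}),
         (0 < n)%N /\ (1 <= k <= #|C|)%N /\ valid_tb tb /\
         mes_vb_av R A tb k X /\ util_ratio R A k X <= K / Num.sqrt (k%:R : R))).
Proof.
split=> [C n A k tb X n0 /andP[k0 _] _ out|].
  by split; [exact: repr_ratio_ge out | exact: util_ratio_ge out].
(* The shape of [k] and the constant 2 come from the utilitarian instance with [r = m.+1]; the
   representation instance works for every positive [k], even with constant 1. *)
exists 2; split=> // m; exists (m.+1 * m.+1 + m.+1)%N; split; first nia.
split; last first.
  have [C [n [A [tb [X [n0 [kC [tbP [out le]]]]]]]]] :=
    util_tight R (ltn0Sn m) erefl.
  by exists C, n, A, tb, X; do 4!(split; first by []).
have k0 : (0 < m.+1 * m.+1 + m.+1)%N by [].
have [C [n [A [tb [X [n0 [kC [tbP [out le]]]]]]]]] := repr_tight R k0.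
exists C, n, A, tb, X; do 4!(split; first by []).
apply: le_trans le _.
by rewrite ler_pM2r ?invr_gt0 ?ltr0n // ler1n.
Qed.
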